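(* As $n\to\infty$, we have $$p(n,n)\le \exp\left(\left(\pi\sqrt{\tfrac23}+o(1)\right)n\sqrt{\log n}\right).$$
   Context: For positive integers $m,n$, let $R=[0,m]\times[0,n]\subset\mathbb{R}^2$. All rectangles have sides parallel to the coordinate axes. A partition of the rectangle $R$ is a multiset of rectangles $\{R_i\}_{i\in I}$ such that: (1) each $R_i$ has positive integer side lengths; (2) rectangles of sizes $k\times l$ and $l\times k$ are regarded as indistinguishable; (3) all the rectangles of the multiset can be arranged so that they cover exactly $R$ and their interiors are pairwise disjoint. Two partitions are the same if they are equal as multisets (of rectangle types, up to rotation); the geometric arrangement is irrelevant. $p(m,n)$ denotes the number of partitions of the $m\times n$ rectangle. *)

(* Defs.v *)
From mathcomp Require Import all_boot all_order all_algebra.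
From mathcomp Require Import finmap multiset.
From mathcomp Require Import all_classical all_reals all_analysis.
From mathcomp Require Import lra.

Set Implicit Arguments.
Unset Strict Implicit.
Unset Printing Implicit Defensive.

Import Order.TTheory GRing.Theory Num.Theory.
Import numFieldNormedType.Exports.

Local Open Scope classical_set_scope.
Local Open Scope ring_scope.
Local Open Scope mset_scope.

Definition box (R : realType) (x y w h : R) : set (R * R) :=
  `[x, x + w] `*` `[y, y + h].

(* The size of a rectangle up to rotation: shape w h = shape h w. *)
Definition shape (w h : nat) : nat * nat := (minn w h, maxn w h).

Definition is_partition (R : realType) (m n : nat) (A : {mset nat * nat}) :
    Prop :=
  exists (k : nat) (x y : 'I_k -> R) (w h : 'I_k -> nat),
    let tile i := box (x i) (y i) (w i)%:R (h i)%:R in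
    [/\ forall i, (0 < w i)%N /\ (0 < h i)%N,
        A = seq_mset [seq shape (w i) (h i) | i <- enum 'I_k],
        \bigcup_i tile i = box 0 0 m%:R n%:R
      & trivIset setT (fun i => (tile i)°)].

Definition partitions (R : realType) (m n : nat) : set {mset nat * nat} :=
  [set A | is_partition R m n A].

Lemma box_interior (R : realType) (x y w h : R) (p : R * R) :
  x < p.1 < x + w -> y < p.2 < y + h -> (box x y w h)° p.
Proof.
case: p => a b /= ha hb.
exists (`[x, x + w]%classic, `[y, y + h]%classic) => //=; split.
- have /near_in_itvoo : a \in `]x, (x + w)[%R by rewrite in_itv.
  by apply: filterS => z; rewrite /= !in_itv /= => /andP[/ltW -> /ltW ->].
- have /near_in_itvoo : b \in `]y, (y + h)[%R by rewrite in_itv.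
  by apply: filterS => z; rewrite /= !in_itv /= => /andP[/ltW -> /ltW ->].
Qed.

(* An interval [x, x + w] of [0, m] with w >= 1 has an element of (1/2)Z in its
   interior. *)
Lemma half_integer_inside (R : realType) (x : R) (w m : nat) :
  0 <= x -> (0 < w)%N -> x + w%:R <= m%:R ->
  exists a : 'I_(m.*2.+1), x < a%:R / 2 < x + w%:R.
Proof.
move=> x0 w0 xwm; have w1 : 1 <= w%:R :> R by rewrite ler1n.
have /truncn_itv /andP[] : 0 <= x * 2 by lra.
set t := Num.truncn _ => t1 t2.
have hin : x < t.+1%:R / 2 < x + w%:R.
  by rewrite -(natr1 t) in t2 *; apply/andP; split; lra.
suff tm : (t.+1 < m.*2.+1)%N by exists (Ordinal tm).
rewrite ltnS -(ler_nat R) -muln2 natrM; case/andP: hin; lra.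
Qed.

Lemma finite_partitions (R : realType) (m n : nat) :
  finite_set (partitions R m n).
Proof.
pose N := maxn m n; pose T := ('I_N.+1 * 'I_N.+1)%type.
pose P := ('I_(m.*2.+1) * 'I_(n.*2.+1))%type.
pose f (s : #|{: P}|.-bseq T) := seq_mset [seq (val u.1, val u.2) | u <- s].
apply: (@sub_finite_set _ _ (range f)); last exact/finite_image/finite_finset.
move=> _ [k [x [y [w [h [wh0 -> cov disj]]]]]].
have inR i : [/\ 0 <= x i, x i + (w i)%:R <= m%:R, 0 <= y i
                & y i + (h i)%:R <= n%:R].
  have sub p : box (x i) (y i) (w i)%:R (h i)%:R p -> box 0 0 m%:R n%:R p.
    by rewrite -cov => ?; exists i.
  have w0 : 0 <= (w i)%:R :> R by [].
  have h0 : 0 <= (h i)%:R :> R by [].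
  have /sub : box (x i) (y i) (w i)%:R (h i)%:R (x i, y i).
    by split; rewrite /= in_itv /= lexx lerDl.
  have /sub : box (x i) (y i) (w i)%:R (h i)%:R
                (x i + (w i)%:R, y i + (h i)%:R).
    by split; rewrite /= in_itv /= lexx lerDl ?w0 ?h0.
  move=> [/= + +] [/= + +]; rewrite !in_itv /= !add0r.
  by move=> /andP[_ ?] /andP[_ ?] /andP[? _] /andP[? _]; split.
have pt i : {u : P | x i < u.1%:R / 2 < x i + (w i)%:R
                     /\ y i < u.2%:R / 2 < y i + (h i)%:R}.
  apply: cid; have [x0 xm y0 yn] := inR i; have [w0 h0] := wh0 i.
  have [a ha] := half_integer_inside x0 w0 xm.
  have [b hb] := half_integer_inside y0 h0 yn.
  by exists (a, b).
have kP : (k <= #|{: P}|)%N.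
  rewrite -[k]card_ord; apply: (@leq_card _ _ (fun i => sval (pt i))) => i j eq.
  apply: disj => //; case: (svalP (pt i)) => i1 i2; case: (svalP (pt j)) => j1 j2.
  exists ((sval (pt i)).1%:R / 2, (sval (pt i)).2%:R / 2).
  by split; apply: box_interior => //=; rewrite eq.
have wN i : (w i < N.+1)%N.
  have [x0 xm _ _] := inR i; rewrite ltnS leq_max -(ler_nat R).
  by apply/orP; left; lra.
have hN i : (h i < N.+1)%N.
  have [_ _ y0 yn] := inR i; rewrite ltnS leq_max -!(ler_nat R).
  by apply/orP; right; lra.
have minN i : (minn (w i) (h i) < N.+1)%N by rewrite gtn_min wN.
have maxN i : (maxn (w i) (h i) < N.+1)%N by rewrite gtn_max wN hN.
pose g i : T := (Ordinal (minN i), Ordinal (maxN i)).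
have sz : (size [seq g i | i <- enum 'I_k] <= #|{: P}|)%N.
  by rewrite size_map size_enum_ord.
by exists (Bseq sz) => //; rewrite /f /= -map_comp.
Qed.

(* fset_set is the empty set on an infinite argument; finite_partitions shows that
   this default value is never used. *)
Definition num_partitions (R : realType) (m n : nat) : nat :=
  #|` fset_set (partitions R m n)|.

(* Main.v *)
Require Import Defs.
From mathcomp Require Import all_boot all_order all_algebra.
From mathcomp Require Import finmap multiset.
From mathcomp Require Import all_classical all_reals all_analysis.
From mathcomp Require Import ring lra.
Import Order.TTheory GRing.Theory Num.Theory.
Import numFieldNormedType.Exports.
Local Open Scope classical_set_scope.
Local Open Scope ring_scope.

Set Implicit Arguments.
Unset Strict Implicit.
Unset Printing Implicit Defensive.

(** Forget the geometry of a partition of the n x n square except for two facts: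
    every tile has a shape (a, b) with 1 <= a <= b <= n, and the areas of the
    tiles add up to at most n ^ 2 (compare Lebesgue measures).  A partition is
    determined by the multiplicities of its shapes, so that num_partitions is at
    most the number of multiplicity functions f with
    \sum_(a, b) f (a, b) * (a * b) <= n ^ 2 (num_partitions_le_card).

    Rankin's trick bounds this number: weighting f by
    exp (t (n ^ 2 - \sum f (a, b) a b)) >= 1 and summing over all f gives an Euler
    product, hence, for all t > 0 (card_weight_le),
      ln (num_partitions n n) <= t n ^ 2 + \sum_(a <= b <= n) F (t a b),
    where F y = - ln (1 - exp (- y)).

    To estimate the sum, compare it with an integral in b alone: F is decreasing
    and is dominated by exp (- y) / sqrt (1 - exp (- y)), whose integral over the
    positive half-line is 2, so \sum_b F (x b) <= 2 / x (sum_euler_log_le).  With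
    x = t a, summing over a yields the harmonic sum (2 / t) (1 + ln n) for the
    whole square of pairs (a, b).  Restricting to a <= b halves this, up to the
    diagonal, which contributes O(1 / t) (sum_triangle).  Therefore
      ln (num_partitions n n) <= t n ^ 2 + (ln n + 3) / t,
    and t = sqrt (ln n) / n makes the right-hand side
    (2 + 3 / ln n) n sqrt (ln n).

    The integral of F itself is pi ^ 2 / 6; using the value 2 instead costs a
    constant factor, but taking only the pairs a <= b saves a factor sqrt 2, and
    the resulting constant 2 is strictly below pi * sqrt (2 / 3) because
    pi ^ 2 >= 8.  The error term can thus be taken to be 0. *)

(** * Two numerical facts *)

Lemma sin_le (R : realType) (x : R) : 0 <= x -> sin x <= x.
Proof.
move=> x0.
have [] := @MVT_segment R sin cos 0 x x0 (fun=> _).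
  apply: continuous_subspaceT => y; exact: continuous_sin.
move=> c _; rewrite sin0 !subr0 => ->.
by rewrite -[leRHS]mul1r ler_wpM2r // cos_le1.
Qed.

(** At x = pi / 4, where sin x ^ 2 = 1 / 2, the inequality sin x <= x reads
    1 / 2 <= pi ^ 2 / 16. *)
Lemma sqr_pi_ge8 (R : realType) : 8 <= pi ^+ 2 :> R.
Proof.
have pi0 : 0 <= pi / 4 :> R by rewrite divr_ge0 // pi_ge0.
have s0 : 0 <= sin (pi / 4) :> R.
  by apply: sin_ge0_pi; rewrite pi0 /=; have := pi_ge0 R; lra.
have := sin_le pi0; rewrite -(@ler_pXn2r _ 2) ?nnegrE // => h.
have := cos2Dsin2 (pi / 4 : R); have := cos_mulr2n (pi / 4 : R).
have -> : (pi / 4) *+ 2 = pi / 2 :> R by rewrite mulr2n; field.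
by rewrite cos_pihalf; move: h; rewrite expr_div_n; lra.
Qed.

(** With r = exp (- h) this is 2 h <= exp h - exp (- h), which holds since the
    difference of the two sides has derivative exp h + exp (- h) - 2 >= 0. *)
Lemma ln_le_sub_inv (R : realType) (r : R) :
  0 < r <= 1 -> - (2 * ln r) <= r^-1 - r.
Proof.
case/andP=> r0 r1; set h := - ln r.
have h0 : 0 <= h by rewrite oppr_ge0 ln_le0.
pose g (z : R) := expR z - expR (- z) - 2 * z.
have dg (z : R) : is_derive z 1 g (expR z + expR (- z) - 2).
  rewrite /g; apply: is_derive_eq; rewrite /GRing.scale/=; ring.
have [|c _] := @MVT_segment R g _ 0 h h0 (fun z _ => dg z).
  apply: continuous_subspaceT => z; apply: differentiable_continuous.
  by apply/derivable1_diffP; case: (dg z).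
have eN : expR (- h) = r by rewrite opprK lnK.
have eP : expR h = r^-1 by rewrite -[LHS]invrK -expRN eN.
rewrite /g eN eP subr0 oppr0 mulr0 subrr !subr0 => e.
have : 0 <= (expR c + expR (- c) - 2) * h.
  by apply: mulr_ge0 => //; have := expR_ge1Dx c; have := expR_ge1Dx (- c); lra.
by rewrite -e /h; lra.
Qed.

(** * The logarithm of an Euler factor *)

(** The logarithm of the geometric sum 1 + exp (- y) + exp (- 2 y) + ... *)
Definition euler_log (R : realType) (y : R) := - ln (1 - expR (- y)).

(** Twice this function is the primitive vanishing at 0 of
    exp (- y) / sqrt (1 - exp (- y)), a majorant of euler_log y. *)
Definition half_prim (R : realType) (y : R) := Num.sqrt (1 - expR (- y)).

(** The comparison of a sum with an integral, on one interval [y, y + x].  Put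
    r = half_prim (y + x) and q = half_prim y.  Then ln_le_sub_inv bounds
    euler_log (y + x) = - 2 ln r by (1 - r ^ 2) / r, while
    r ^ 2 - q ^ 2 = exp (- (y + x)) (exp x - 1) >= x (1 - r ^ 2); so the left-hand
    side is at most (r - q) (r + q) / r <= 2 (r - q). *)
Lemma euler_log_step (R : realType) (x y : R) : 0 < x -> 0 <= y ->
  x * euler_log (y + x) <= 2 * (half_prim (y + x) - half_prim y).
Proof.
move=> x0 y0; rewrite /euler_log.
set r := half_prim (y + x); set q := half_prim y.
have expN1 (z : R) : 0 <= z -> 0 <= 1 - expR (- z).
  by move=> z0; rewrite subr_ge0 -expR0 ler_expR; lra.
have r2 : r ^+ 2 = 1 - expR (- (y + x)) by rewrite sqr_sqrtr // expN1; lra.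
have q2 : q ^+ 2 = 1 - expR (- y) by rewrite sqr_sqrtr // expN1.
have r0 : 0 < r by rewrite sqrtr_gt0 subr_gt0 -expR0 ltr_expR; lra.
have q0 : 0 <= q by exact: sqrtr_ge0.
have u0 := expR_gt0 (- (y + x)).
have qr : q <= r.
  by rewrite ler_sqrt ?expN1 ?lerD2l ?lerN2 ?ler_expR; lra.
have r1 : r <= 1 by rewrite -[leRHS]sqrtr1 ler_sqrt // gerBl expR_ge0.
have -> : ln (1 - expR (- (y + x))) = 2 * ln r by rewrite -r2 lnXn // mulr_natl.
have /(ler_wpM2l (ltW x0)) h : - (2 * ln r) <= r^-1 - r.
  by apply: ln_le_sub_inv; rewrite r0.
apply: (le_trans h).
have step : x * (1 - r ^+ 2) <= r ^+ 2 - q ^+ 2.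
  have -> : r ^+ 2 - q ^+ 2 = expR (- (y + x)) * (expR x - 1).
    have -> : expR (- (y + x)) * (expR x - 1) = expR (- y) - expR (- (y + x)).
      by rewrite mulrBr mulr1 -expRD; congr (expR _ - _); lra.
    by rewrite r2 q2; lra.
  by rewrite r2 opprB addrC subrK mulrC ler_wpM2l ?(ltW u0) //;
     have := expR_ge1Dx x; lra.
have -> : x * (r^-1 - r) = x * (1 - r ^+ 2) / r by field; lra.
rewrite ler_pdivrMr //; apply: (le_trans step).
rewrite -subr_ge0.
have -> : 2 * (r - q) * r - (r ^+ 2 - q ^+ 2) = (r - q) ^+ 2 by ring.
exact: sqr_ge0.
Qed.

(** The steps telescope, and half_prim takes values in [0, 1]. *)
Lemma sum_euler_log_le (R : realType) (x : R) (n : nat) : 0 < x ->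
  \sum_(b < n) euler_log (x * b.+1%:R) <= 2 / x.
Proof.
move=> x0; rewrite ler_pdivlMr // mulrC.
apply: (@le_trans _ _ (2 * half_prim (x * n%:R))); last first.
  rewrite -[leRHS]mulr1 ler_wpM2l // -[leRHS]sqrtr1 /half_prim.
  by rewrite ler_sqrt // gerBl expR_ge0.
elim: n => [|n IH]; first by rewrite big_ord0 mulr0 mulr_ge0 ?sqrtr_ge0.
rewrite big_ord_recr /= mulrDr -natr1 mulrDr mulr1.
have := @euler_log_step _ x (x * n%:R) x0.
rewrite mulr_ge0 ?(ltW x0) // => /(_ isT).
move: IH; lra.
Qed.

(** * Summation over shapes *)

(** Each new term satisfies 1 / (n + 1) <= - ln (1 - 1 / (n + 1))
    = ln (n + 1) - ln n. *)
Lemma sum_harmonic_le (R : realType) (n : nat) : (0 < n)%N ->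
  \sum_(a < n) a.+1%:R^-1 <= 1 + ln n%:R :> R.
Proof.
case: n => // n _; elim: n => [|n IH].
  by rewrite big_ord1 invr1 ln1 addr0.
rewrite big_ord_recr /=; apply: le_trans (lerD IH (lexx _)) _.
rewrite -addrA lerD2l.
have n2 : n.+2%:R = n.+1%:R + 1 :> R by rewrite natr1.
have n0 : 0 < n.+1%:R :> R by [].
have e : n.+1%:R / n.+2%:R = 1 - n.+2%:R^-1 :> R.
  by rewrite n2; set m := n.+1%:R in n0 *; field; lra.
have := @le_ln1Dx R (- n.+2%:R^-1).
rewrite -e ln_div ?posrE // ltrN2 invf_lt1 // ltr1n => /(_ isT).
by rewrite lerBlDr [- _ + _]addrC lerBrDr.
Qed.

(** Proved in the stronger form with bound 2 - 1 / n, which is inductive. *)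
Lemma sum_inv_sqr_le (R : realType) (n : nat) :
  \sum_(a < n) (a.+1%:R ^+ 2)^-1 <= 2 :> R.
Proof.
case: n => [|n]; first by rewrite big_ord0.
suff : \sum_(a < n.+1) (a.+1%:R ^+ 2)^-1 <= 2 - n.+1%:R^-1 :> R.
  by move=> /le_trans; apply; rewrite gerBl.
elim: n => [|n IH]; first by rewrite big_ord1 expr1n invr1; lra.
rewrite big_ord_recr /=; apply: le_trans (lerD IH (lexx _)) _.
have n0 : 0 < n.+1%:R :> R by [].
rewrite -[n.+2%:R]natr1 -subr_ge0; set m := n.+1%:R in n0 *.
have -> : 2 - (m + 1)^-1 - (2 - m^-1 + ((m + 1) ^+ 2)^-1) =
  (m * (m + 1) ^+ 2)^-1 by field; lra.
by rewrite invr_ge0; apply: mulr_ge0; [exact: ltW | exact: sqr_ge0].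
Qed.

Lemma euler_log_le (R : realType) (x : R) : 0 < x -> euler_log x <= 2 / x.
Proof. by move=> /(@sum_euler_log_le R x 1); rewrite big_ord1 mulr1. Qed.

Lemma sum_triangle (R : comNzRingType) (n : nat) (F : 'I_n -> 'I_n -> R) :
  (forall i j, F i j = F j i) ->
  2 * (\sum_(i < n) \sum_(j < n | (i <= j)%N) F i j) =
  \sum_i \sum_j F i j + \sum_i F i i.
Proof.
move=> Fsym; rewrite mulr_natl mulr2n.
have {2}-> : \sum_(i < n) \sum_(j < n | (i <= j)%N) F i j =
    \sum_(i < n) \sum_(j < n | (j <= i)%N) F i j.
  rewrite (exchange_big_dep predT) //=; apply: eq_bigr => j _.
  by apply: eq_bigr => i _; rewrite Fsym.
rewrite -!big_split /=; apply: eq_bigr => i _.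
rewrite [X in _ = X + _](bigID (fun j : 'I_n => (i <= j)%N)) /= -addrA.
congr (_ + _); rewrite (bigD1 i) //= addrC; congr (_ + _).
by apply: eq_bigl => j; rewrite -ltnNge ltn_neqAle andbC.
Qed.

Lemma sum_euler_log_shapes_le (R : realType) (t : R) (n : nat) :
  0 < t -> (0 < n)%N ->
  \sum_(p : 'I_n * 'I_n | (p.1 <= p.2)%N) euler_log (t * (p.1.+1 * p.2.+1)%:R)
    <= (3 + ln n%:R) / t.
Proof.
move=> t0 n0.
rewrite -(pair_big_dep predT (fun i j : 'I_n => (i <= j)%N)
           (fun i j => euler_log (t * (i.+1 * j.+1)%:R))) /=.
rewrite -(ler_pM2l (ltr0n R 2)) sum_triangle; last first.
  by move=> i j; rewrite mulnC.
have pos (i : 'I_n) : 0 < t * i.+1%:R by rewrite mulr_gt0.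
have all_le : \sum_(i < n) \sum_(j < n) euler_log (t * (i.+1 * j.+1)%:R)
    <= 2 / t * (1 + ln n%:R).
  apply: (@le_trans _ _ (\sum_(i < n) 2 / t * i.+1%:R^-1)).
    apply: ler_sum => i _.
    under eq_bigr do rewrite natrM mulrA.
    by apply: le_trans (sum_euler_log_le _ (pos i)) _; rewrite invfM mulrA.
  rewrite -mulr_sumr ler_wpM2l ?sum_harmonic_le //.
  by rewrite divr_ge0 // ltW.
have diag_le : \sum_(i < n) euler_log (t * (i.+1 * i.+1)%:R) <= 2 / t * 2.
  apply: (@le_trans _ _ (\sum_(i < n) 2 / t * (i.+1%:R ^+ 2)^-1)).
    apply: ler_sum => i _; rewrite -mulrA -invfM -natrX.
    by apply: euler_log_le; rewrite mulr_gt0.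
  rewrite -mulr_sumr ler_wpM2l ?sum_inv_sqr_le //.
  by rewrite divr_ge0 // ltW.
apply: le_trans (lerD all_le diag_le) _.
by rewrite -mulrDr -mulrA [t^-1 * _]mulrC; lra.
Qed.

(** * Rankin's bound *)

(** Every f that is counted satisfies 1 <= exp (s (N - \sum_t f t * a t)).  The
    sum of the right-hand side over all f factors into truncated geometric series,
    one for each t. *)
Lemma card_weight_le (R : realType) (T : finType) (a : T -> nat) (N : nat)
    (s : R) :
  0 < s -> (forall t, 0 < a t)%N ->
  #|[pred f : {ffun T -> 'I_N.+1} | (\sum_t f t * a t <= N)%N]|%:R
    <= expR (s * N%:R + \sum_t euler_log (s * (a t)%:R)).
Proof.
move=> s0 a0; rewrite -sum1_card natr_sum expRD expR_sum.
have term t : \sum_(k < N.+1) expR (- (s * (k * a t)%:R))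
    <= expR (euler_log (s * (a t)%:R)).
  have sa0 : 0 < s * (a t)%:R by rewrite mulr_gt0 // ltr0n.
  set u := expR (- (s * (a t)%:R)).
  have u0 : 0 < u := expR_gt0 _.
  have u1 : u < 1 by rewrite -expR0 ltr_expR oppr_lt0.
  rewrite /euler_log -/u expRN lnK ?posrE ?subr_gt0 //.
  have := @geometric_le_lim R N.+1 1 u ler01 u0.
  rewrite gtr0_norm // u1 mul1r => /(_ isT); apply: le_trans.
  rewrite /series /= big_mkord; apply: ler_sum => k _.
  by rewrite mul1r -expRM_natl natrM mulrN mulrCA.
apply: (@le_trans _ _ (\sum_(f : {ffun T -> 'I_N.+1})
    expR (s * N%:R) * \prod_t expR (- (s * (f t * a t)%:R)))).
  rewrite [leRHS](bigID [pred f : {ffun T -> 'I_N.+1} |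
    (\sum_t f t * a t <= N)%N]) /=.
  rewrite -[leLHS]addr0; apply: lerD.
    apply: ler_sum => f /= fN.
    rewrite -expR_sum -expRD -[leLHS]expR0 ler_expR sumrN -mulr_sumr -mulrBr.
    by rewrite mulr_ge0 ?(ltW s0) // -natr_sum subr_ge0 ler_nat.
  apply: sumr_ge0 => f _; apply: mulr_ge0; first exact: expR_ge0.
  by apply: prodr_ge0 => t _; exact: expR_ge0.
rewrite -mulr_sumr ler_wpM2l ?expR_ge0 //.
rewrite -(bigA_distr_bigA (fun t (k : 'I_N.+1) => expR (- (s * (k * a t)%:R)))).
apply: ler_prod => t _; rewrite term andbT.
by apply: sumr_ge0 => k _; exact: expR_ge0.
Qed.

(** * From tilings to multiplicities *)

Lemma box_sub_le (R : realType) (x y w h W H : R) :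
  0 <= w -> 0 <= h -> box x y w h `<=` box 0 0 W H -> w <= W /\ h <= H.
Proof.
move=> w0 h0 sub.
have /sub : box x y w h (x, y) by split; rewrite /= in_itv /= lexx lerDl.
have /sub : box x y w h (x + w, y + h).
  by split; rewrite /= in_itv /= lexx lerDl ?w0 ?h0.
move=> [/= + +] [/= + +]; rewrite !in_itv /= !add0r; lra.
Qed.

(** The boxes only have disjoint interiors, so additivity of the Lebesgue measure
    of the plane is applied to the open rectangles inside them. *)
Lemma sum_area_le (R : realType) (k : nat) (x y w h : 'I_k -> R) (W H : R) :
  (forall i, 0 < w i) -> (forall i, 0 < h i) -> 0 <= W -> 0 <= H ->
  (forall i, box (x i) (y i) (w i) (h i) `<=` box 0 0 W H) ->
  trivIset setT (fun i => (box (x i) (y i) (w i) (h i))°) ->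
  \sum_i w i * h i <= W * H.
Proof.
move=> w0 h0 W0 H0 sub disj.
pose leb := @lebesgue_measure R.
pose mu := (leb \x leb)%E.
pose U i := `]x i, x i + w i[%classic `*` `]y i, y i + h i[%classic.
have leb_itv b c (a l : R) : 0 <= l ->
    leb [set` Interval (BSide b a) (BSide c (a + l))] = l%:E.
  move=> l0; rewrite /leb lebesgue_measure_itv /= lte_fin.
  case: ifPn => [_|]; first by rewrite -EFinB addrAC subrr add0r.
  by rewrite -leNgt gerDl => l0'; congr EFin; apply/le_anti; rewrite l0 l0'.
have mU i : measurable (U i) by apply: measurableX; exact: measurable_itv.
have mbox : measurable (box 0 0 W H).
  by apply: measurableX; exact: measurable_itv.
have muU i : mu (U i) = (w i * h i)%:E.
  rewrite /mu product_measure1E; [|exact: measurable_itv..].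
  by rewrite EFinM; congr (_ * _)%E; apply: leb_itv; exact: ltW.
have mubox : mu (box 0 0 W H) = (W * H)%:E.
  rewrite /mu product_measure1E; [|exact: measurable_itv..].
  by rewrite EFinM; congr (_ * _)%E; exact: leb_itv.
have Usub i : U i `<=` (box (x i) (y i) (w i) (h i))°.
  by move=> p [/= + +]; rewrite !in_itv; exact: box_interior.
have trivU : trivIset setT U.
  by move=> i j _ _ [p [/Usub ? /Usub ?]]; apply: disj => //; exists p.
rewrite -lee_fin -mubox -sumEFin.
rewrite (eq_bigr (fun i => mu (U i))) => [|i _]; last by rewrite muU.
rewrite -measure_bigsetU_ord //; apply: le_measure; rewrite ?inE //.
  by apply: bigsetU_measurable => i _; exact: mU.
elim/big_ind: _ => [|A B subA subB|i _]; first exact: sub0set.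
  by rewrite subUset.
apply: subset_trans (sub i).
by apply: subset_trans (Usub i) (@interior_subset _ _).
Qed.

(** The possible shapes of a tile, with the pair (i, j) standing for the rectangle
    of size (i + 1) x (j + 1). *)
Definition shape_index (n : nat) := {p : 'I_n * 'I_n | (p.1 <= p.2)%N}.
Definition index_shape (n : nat) (p : shape_index n) : nat * nat :=
  ((val p).1.+1, (val p).2.+1).
Definition area (n : nat) (p : shape_index n) : nat :=
  (val p).1.+1 * (val p).2.+1.

Lemma index_shape_inj n : injective (@index_shape n).
Proof.
move=> [[i j] ij] [[i' j'] ij'] [ei ej]; apply: val_inj => /=.
by congr (_, _); apply: val_inj.
Qed.

Lemma shape_indexP (n w h : nat) : (0 < w <= n)%N -> (0 < h <= n)%N ->
  exists2 p : shape_index n, Defs.shape w h = index_shape p & area p = (w * h)%N.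
Proof.
wlog wh : w h / (w <= h)%N => [hwlog|].
  move=> wn hn; have /orP[wh|hw] := leq_total w h; first exact: hwlog.
  have [p pE aE] := hwlog _ _ hw hn wn.
  by exists p; [rewrite -pE /Defs.shape minnC maxnC | rewrite mulnC].
case: w wh => // w wh /andP[_ wn]; case: h wh => // h wh /andP[_ hn].
exists (exist _ (Ordinal wn, Ordinal hn) wh) => //.
by rewrite /Defs.shape (minn_idPl wh) (maxn_idPr wh).
Qed.

(** The first part lets a partition be recovered from its multiplicities on
    shape_index; the second is sum_area_le, with the tiles grouped by shape. *)
Lemma partition_weight (R : realType) (n : nat) (A : {mset nat * nat}%mset) :
  is_partition R n n A ->
  (forall s, A s != 0%N -> exists p : shape_index n, s = index_shape p) /\
  (\sum_(p : shape_index n) A (index_shape p) * area p <= n * n)%N.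
Proof.
move=> [k [x [y [w [h [wh0 -> cov disj]]]]]].
have sub i : box (x i) (y i) (w i)%:R (h i)%:R `<=` box 0 0 n%:R n%:R.
  by rewrite -cov => p ?; exists i.
have wh_le i : (w i <= n)%N /\ (h i <= n)%N.
  by rewrite -!(ler_nat R); apply: box_sub_le (sub i); exact: ler0n.
have /all_sig2[q qE qA] i :
    {q : shape_index n | Defs.shape (w i) (h i) = index_shape q
                       & area q = (w i * h i)%N}.
  apply: cid2; have [w0 h0] := wh0 i; have [wn hn] := wh_le i.
  by apply: shape_indexP; apply/andP.
split.
  move=> s; rewrite mset_seqE -lt0n -has_count => /hasP[_ /mapP[i _ ->]].
  by move=> /eqP <-; exists (q i).
have -> : (\sum_(p : shape_index n)
      seq_mset [seq Defs.shape (w i) (h i) | i <- enum 'I_k] (index_shape p) * area p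
    = \sum_i w i * h i)%N.
  transitivity (\sum_(p : shape_index n) \sum_(i | q i == p) w i * h i)%N.
    apply: eq_bigr => p _.
    rewrite mset_seqE count_map -size_filter -sum1_size big_distrl /=.
    rewrite big_filter big_enum_cond /=; apply: eq_big => [i|i].
      by rewrite qE (inj_eq (@index_shape_inj n)).
    by rewrite qE (inj_eq (@index_shape_inj n)) => /eqP <-; rewrite mul1n qA.
  by rewrite (partition_big q predT).
rewrite -(ler_nat R) natr_sum natrM; under eq_bigr do rewrite natrM.
apply: sum_area_le sub disj => // i; rewrite ltr0n; by case: (wh0 i).
Qed.

(** A multiplicity is at most the total area n * n, because every shape has area
    at least 1; multiplicity functions thus take values in a finite type. *)
Lemma num_partitions_le_card (R : realType) (n : nat) :
  (num_partitions R n n <=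
   #|[pred f : {ffun shape_index n -> 'I_(n * n).+1} |
       (\sum_p f p * area p <= n * n)%N]|)%N.
Proof.
pose mult (A : {mset nat * nat}%mset) : {ffun shape_index n -> 'I_(n * n).+1} :=
  [ffun p => inord (A (index_shape p))].
have multE A p : is_partition R n n A -> mult A p = A (index_shape p) :> nat.
  move=> /partition_weight[_ Aw]; rewrite ffunE inordK // ltnS.
  apply: leq_trans Aw; rewrite (bigD1 p) //=; apply: leq_trans (leq_addr _ _).
  exact: leq_pmulr.
have partP A : (A \in fset_set (partitions R n n)) -> is_partition R n n A.
  by rewrite in_fset_set ?inE //; exact: finite_partitions.
rewrite /num_partitions cardE -(size_map mult).
apply: uniq_leq_size.
  rewrite map_inj_in_uniq ?fset_uniq // => A B /partP pA /partP pB eAB.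
  apply/msetP => s; have [supA _] := partition_weight pA.
  have [supB _] := partition_weight pB.
  have eqs (p : shape_index n) : A (index_shape p) = B (index_shape p).
    by rewrite -(multE _ _ pA) -(multE _ _ pB) eAB.
  have [A0|/supA[p ->]] := eqVneq (A s) 0%N; last exact: eqs.
  have [B0|/supB[p ->]] := eqVneq (B s) 0%N; last exact: eqs.
  by rewrite A0 B0.
move=> _ /mapP[A /partP pA ->]; rewrite mem_enum inE.
under eq_bigr do rewrite (multE _ _ pA).
by have [] := partition_weight pA.
Qed.

Lemma num_partitions_le (R : realType) (n : nat) (t : R) :
  0 < t -> (0 < n)%N ->
  (num_partitions R n n)%:R <= expR (t * (n * n)%:R + (3 + ln n%:R) / t).
Proof.
move=> t0 n0; have := num_partitions_le_card R n; rewrite -(ler_nat R).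
move=> /le_trans; apply; apply: le_trans (card_weight_le _ t0 _) _ => //.
rewrite ler_expR lerD2l; apply: le_trans (sum_euler_log_shapes_le t0 n0).
by rewrite [leRHS]big_sub.
Qed.

(** * The asymptotic bound *)

Theorem theorem1p5 (R : realType) :
  exists eps : R^nat,
    eps n @[n --> \oo] --> (0 : R) /\
    \forall n \near \oo,
      (num_partitions R n n)%:R <=
        expR ((pi * Num.sqrt (2 / 3) + eps n) * n%:R * Num.sqrt (ln n%:R)).
Proof.
exists (fun=> 0); split; first exact: cvg_cst.
set c := pi * Num.sqrt (2 / 3).
have c2 : 2 < c.
  have c0 : 0 <= c by rewrite mulr_ge0 ?pi_ge0 ?sqrtr_ge0.
  rewrite -(@ltr_pXn2r _ 2) ?nnegrE // exprMn sqr_sqrtr //.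
  by have := sqr_pi_ge8 R; lra.
near=> n.
(* This threshold makes 3 / ln n, the excess over 2, at most c - 2. *)
have n_big : expR (3 / (c - 2)) <= n%:R by near: n; exact: nbhs_infty_ger.
have n0 : 0 < n%:R :> R by apply: lt_le_trans n_big; exact: expR_gt0.
have L_big : 3 / (c - 2) <= ln n%:R by rewrite -ler_expR lnK.
have L0 : 0 < ln n%:R :> R.
  by apply: lt_le_trans L_big; rewrite divr_gt0 ?subr_gt0.
set r := Num.sqrt (ln n%:R).
have r0 : 0 < r by rewrite sqrtr_gt0.
have r2 : ln n%:R = r ^+ 2 by rewrite sqr_sqrtr // ltW.
(* This t balances the two terms t n ^ 2 and ln n / t. *)
have := @num_partitions_le R n (r / n%:R); rewrite divr_gt0 // -(ltr0n R) n0.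
move=> /(_ isT isT) /le_trans; apply; rewrite ler_expR addr0.
have -> : r / n%:R * (n * n)%:R + (3 + ln n%:R) / (r / n%:R) =
    (2 * r ^+ 2 + 3) * (n%:R / r).
  by rewrite r2 natrM; set m := n%:R in n0 *; field; lra.
have -> : c * n%:R * r = c * r ^+ 2 * (n%:R / r).
  by set m := n%:R in n0 *; field; lra.
apply: ler_wpM2r; first by rewrite divr_ge0 ?ltW.
by move: L_big; rewrite ler_pdivrMr ?subr_gt0 // r2; lra.
Unshelve. all: by end_near. Qed.
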